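(* Let $\mathcal{X}$ be a fuzzy random variable with values in $\mathcal{F}_c(\mathbb{R})$ such that $\mathrm{E}[\|\mathcal{X}_0\|]<\infty$. Then $D_1$ satisfies property P3b for the metric $\rho_1$: for every $A\in\mathcal{F}_c(\mathbb{R})$ with $D_1(A;\mathcal{X})=\sup\{D_1(B;\mathcal{X}):B\in\mathcal{F}_c(\mathbb{R})\}$ and all $U,V\in\mathcal{F}_c(\mathbb{R})$ with $\rho_1(A,V)=\rho_1(A,U)+\rho_1(U,V)$, we have $D_1(A;\mathcal{X})\ge D_1(U;\mathcal{X})\ge D_1(V;\mathcal{X})$.
   Context: $\mathcal{F}_c(\mathbb{R})$ is the set of functions $A:\mathbb{R}\to[0,1]$ whose $\alpha$-levels $A_\alpha=\{x:A(x)\ge\alpha\}$ ($\alpha\in(0,1]$) and $A_0=\overline{\{x:A(x)>0\}}$ are non-empty compact intervals. Support function: $s_A(u,\alpha)=\sup\{uv:v\in A_\alpha\}$, $u\in\{-1,1\}$, $\alpha\in[0,1]$. A fuzzy random variable on $(\Omega,\mathcal{A},\mathbb{P})$ is a map $\mathcal{X}:\Omega\to\mathcal{F}_c(\mathbb{R})$ with each $\omega\mapsto\mathcal{X}(\omega)_\alpha$ a random compact set; $\|\mathcal{X}_0\|=\sup\{|x|:x\in\mathcal{X}(\cdot)_0\}$. $\rho_1(A,B)=\int_{\{-1,1\}}\int_0^1|s_A(u,\alpha)-s_B(u,\alpha)|\,d\alpha\,d\mathcal{V}(u)$, $\mathcal{V}$ uniform on $\{-1,1\}$. The 1-natural depth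 is $D_1(A;\mathcal{X})=(1+\mathrm{E}[\rho_1(A,\mathcal{X})])^{-1}$ (set to $0$ if the expectation is infinite). *)

(* Defs.v *)
From HB Require Import structures.
From mathcomp Require Import all_boot all_order all_algebra.
From mathcomp Require Import all_classical all_reals all_analysis.
Set Implicit Arguments. Unset Strict Implicit. Unset Printing Implicit Defensive.
Import Order.TTheory GRing.Theory Num.Theory.
Import numFieldNormedType.Exports.
Local Open Scope classical_set_scope.
Local Open Scope ring_scope.

Section FuzzyDefs.
Variable R : realType.

Definition level (A : R -> R) (alpha : R) : set R :=
  if alpha == 0 then closure [set x | 0 < A x] else [set x | alpha <= A x].

Definition isFc (A : R -> R) : Prop :=
  (forall x, 0 <= A x <= 1) /\
  (forall alpha, 0 <= alpha <= 1 ->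
     exists a b : R, a <= b /\ level A alpha = `[a, b]%classic).

Definition supp_fun (A : R -> R) (u alpha : R) : R :=
  sup [set u * v | v in level A alpha].

(* rho_1 : integral over u in {-1,1} w.r.t. the uniform measure and
   over alpha in [0,1] w.r.t. Lebesgue measure *)
Definition rho1 (A B : R -> R) : \bar R :=
  ((2^-1)%:E *
   ((\int[lebesgue_measure]_(a in `[0%R, 1%R]%classic)
        (`|supp_fun A 1 a - supp_fun B 1 a|)%:E) +
    (\int[lebesgue_measure]_(a in `[0%R, 1%R]%classic)
        (`|supp_fun A (-1) a - supp_fun B (-1) a|)%:E)))%E.

(* random compact set (Effros / hitting-compact measurability) *)
Definition random_compact_set d (T : measurableType d) (S : T -> set R) : Prop :=
  (forall w, compact (S w)) /\
  (forall K : set R, compact K -> measurable [set w | S w `&` K !=set0]).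

Definition fuzzy_random_variable d (T : measurableType d) (X : T -> R -> R) : Prop :=
  (forall w, isFc (X w)) /\
  (forall alpha, 0 <= alpha <= 1 ->
     random_compact_set (fun w => level (X w) alpha)).

Definition norm0 (A : R -> R) : R := sup [set `|x| | x in level A 0].

Definition D1 d (T : measurableType d) (P : probability T R) (A : R -> R)
  (X : T -> R -> R) : R :=
  match (\int[P]_w rho1 A (X w))%E with
  | r%:E => (1 + r)^-1
  | _ => 0
  end.

End FuzzyDefs.

(* Main.v *)
(* Write s_B(u, a) for the support function of B and g(u, a, t) = E|t - s_X(u, a)|, so that
   E[rho_1(B, X)] is half the integral over a, summed over u = 1, -1, of g(u, a, s_B(u, a)).
   The upper medians of the variables s_X(u, a) are again the support function of some
   fuzzy set M, hence M minimizes g(u, a, .) for every u and every a in ]0, 1].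
   Since g(u, a, .) is convex and 1-Lipschitz,
     g(s_U) + g(s_M) + |s_A - s_V| <= g(s_V) + g(s_A) + |s_A - s_U| + |s_U - s_V|,
   and integrating this,
     E rho_1(U,X) + E rho_1(M,X) + rho_1(A,V)
       <= E rho_1(V,X) + E rho_1(A,X) + rho_1(A,U) + rho_1(U,V).
   The rho_1-terms cancel when U lies between A and V, and a deepest A satisfies
   E rho_1(A,X) <= E rho_1(M,X), which leaves E rho_1(U,X) <= E rho_1(V,X). *)
Require Import Defs.
From HB Require Import structures.
From mathcomp Require Import all_boot all_order all_algebra.
From mathcomp Require Import all_classical all_reals all_analysis.
From mathcomp Require Import measurable_realfun ring lra.
Set Implicit Arguments. Unset Strict Implicit. Unset Printing Implicit Defensive.
Import Order.TTheory GRing.Theory Num.Theory.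
Import numFieldNormedType.Exports.
Local Open Scope classical_set_scope.
Local Open Scope ring_scope.

(** * Support functions of fuzzy sets *)

(* The second clause is left-continuity on ]0, 1] of the nonincreasing h.
   Support functions are also right-continuous at 0, but this concerns a null set. *)
Definition profile (R : realType) (h : R -> R) : Prop :=
  (forall a b, 0 <= a -> a <= b -> b <= 1 -> h b <= h a) /\
  (forall a x, 0 < a -> a <= 1 -> (forall b, 0 < b -> b < a -> x <= h b) ->
     x <= h a).

Section SupportFunctions.
Context {R : realType}.
Implicit Types (A : R -> R) (a b u x : R).

Lemma level_nonincreasing A a b : 0 <= a -> a <= b -> level A b `<=` level A a.
Proof.
rewrite /level => a0 ab; case: eqP => [b0|/eqP b0].
  have -> : a = 0 by apply/le_anti; rewrite a0 andbT -b0.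
  by rewrite eqxx.
case: eqP => [a0'|_] x /= bx; last exact: le_trans bx.
apply: subset_closure => /=; apply: lt_le_trans bx.
by rewrite lt_neqAle eq_sym b0 (le_trans a0).
Qed.

Lemma supp_fun_segment A a : isFc A -> 0 <= a -> a <= 1 ->
  exists l r, [/\ l <= r, level A a = `[l, r]%classic,
    supp_fun A 1 a = r & supp_fun A (-1) a = - l].
Proof.
move=> [_ FA] a0 a1; have [|l [r [lr E]]] := FA a; first by rewrite a0.
have sup_eq (S : set R) y : S y -> ubound S y -> sup S = y.
  move=> Sy uSy; apply/le_anti/andP; split; first by apply: ge_sup => //; exists y.
  by apply: ub_le_sup => //; exists y.
exists l, r; split=> //; rewrite /supp_fun E; apply: sup_eq.
- by exists r; rewrite ?mul1r//= in_itv/= lr lexx.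
- by move=> _ [v /= + <-]; rewrite in_itv/= mul1r => /andP[].
- by exists l; rewrite ?mulN1r//= in_itv/= lr lexx.
- by move=> _ [v /= + <-]; rewrite in_itv/= mulN1r lerN2 => /andP[].
Qed.

Lemma norm1_cases u : `|u| = 1 -> u = 1 \/ u = -1.
Proof.
by move/eqP; rewrite eqr_norml => /andP[/orP[]/eqP -> _]; [left|right].
Qed.

(** Compactness of the level makes the supremum attained. Both left-continuity and measurability of
    support functions rest on this hitting condition. *)
Lemma le_supp_fun A u a x : isFc A -> `|u| = 1 -> 0 <= a -> a <= 1 ->
  x <= supp_fun A u a <-> exists2 v, level A a v & x <= u * v.
Proof.
move=> FA u1 a0 a1; have [l [r [lr -> s1 sN1]]] := supp_fun_segment FA a0 a1.
have [->|->] := norm1_cases u1; rewrite ?s1 ?sN1; split => [xs|[v /=]].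
- by exists r; rewrite ?mul1r//= in_itv/= lr lexx.
- by rewrite in_itv/= mul1r => /andP[_ vr] /le_trans; exact.
- by exists l; rewrite ?mulN1r//= in_itv/= lr lexx.
- by rewrite in_itv/= mulN1r => /andP[lv _] /le_trans; apply; rewrite lerN2.
Qed.

(** Monotonicity comes from the nesting of levels. For left-continuity, the single point [u * x] is
    shown to lie in every level of order below [a], which forces [a <= A (u * x)]. *)
Lemma profile_supp_fun A u : isFc A -> `|u| = 1 -> profile (supp_fun A u).
Proof.
move=> FA u1; split=> [a b a0 ab b1|a x a0 a1 xs].
  apply/(le_supp_fun _ FA u1 a0 (le_trans ab b1)).
  have [v vb sv] := (le_supp_fun _ FA u1 (le_trans a0 ab) b1).1 (lexx _).
  by exists v => //; exact: level_nonincreasing vb.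
rewrite leNgt; apply/negP => sx.
have [l [r [lr E _ _]]] := supp_fun_segment FA (ltW a0) a1.
have El : level A a l by rewrite E /= in_itv/= lexx.
have uu : u * u = 1 by have [->|->] := norm1_cases u1; rewrite ?mulrNN mul1r.
have ul : u * l < x.
  rewrite ltNge; apply/negP => xl; move: sx; rewrite ltNge => /negP; apply.
  by apply/(le_supp_fun _ FA u1 (ltW a0) a1); exists l.
(* Level [b] contains [l], where [u * l < x], and some [v] with [x <= u * v]; being an interval, it
   contains [u * x]. *)
have lvlb b : 0 < b -> b < a -> b <= A (u * x).
  move=> b0 ba; have b1 := le_trans (ltW ba) a1.
  have [v vb xv] := (le_supp_fun _ FA u1 (ltW b0) b1).1 (xs _ b0 ba).
  have lb := level_nonincreasing (ltW b0) (ltW ba) El.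
  suff : level A b (u * x) by rewrite /level gt_eqF.
  move: lb vb; have [l' [r' [_ -> _ _]]] := supp_fun_segment FA (ltW b0) b1.
  rewrite /= !in_itv/= => /andP[l'l lr'] /andP[l'v vr'].
  have [u1'|u1'] := norm1_cases u1; move: ul xv; rewrite u1'; lra.
have : a <= A (u * x).
  rewrite leNgt; apply/negP => Aa.
  have /andP[A0 _] := FA.1 (u * x).
  by have := lvlb ((A (u * x) + a) / 2); lra.
move=> aA; move: sx; rewrite ltNge => /negP; apply.
apply/(le_supp_fun _ FA u1 (ltW a0) a1); exists (u * x).
  by rewrite /level gt_eqF.
by rewrite mulrA uu mul1r.
Qed.

Lemma closure_inf (S : set R) : S !=set0 -> has_lbound S -> closure S (inf S).
Proof.
move=> [x Sx] [m mS] U nU.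
have : closure (-%R @` S) (sup (-%R @` S)).
  apply: closure_sup; first by exists (- x), x.
  by exists (- m) => _ [y Sy <-]; rewrite lerN2 mS.
have nNU : nbhs (sup (-%R @` S)) (-%R @^-1` U) by exact: oppr_continuous nU.
by move=> /(_ _ nNU)[_ [[y Sy <-]]]; rewrite /= opprK; exists y.
Qed.

(** Serves the 0-level of the fuzzy set built below: the closure of an interval that need not be
    closed. *)
Lemma closure_interval (S : set R) : S !=set0 -> has_ubound S -> has_lbound S ->
  is_interval S -> closure S = `[inf S, sup S]%classic.
Proof.
move=> S0 ubS lbS iS; apply/seteqP; split.
  have -> : `[inf S, sup S]%classic = closure (`[inf S, sup S]%classic : set R).
    by apply/closure_id; exact: interval_closed.
  apply: closureS => x Sx /=; rewrite in_itv/=.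
  by rewrite ub_le_sup//= ge_inf.
move=> x /=; rewrite in_itv/= => /andP[].
rewrite le_eqVlt => /predU1P[<- _|ix]; first exact: closure_inf.
rewrite le_eqVlt => /predU1P[->|xs]; first exact: closure_sup.
apply: subset_closure.
have [y Sy xy] := sup_gt S0 xs.
have [z Sz zx] := inf_lt S0 ix.
by apply: (iS z y) => //; rewrite (ltW zx) (ltW xy).
Qed.

(** [M x] is the largest order [a] whose segment [[- h2 a, h1 a]] contains [x]; left-continuity
    makes this segment exactly the level of order [a]. At order 0 the level is a closure, so the
    profiles need not be recovered there. *)
Lemma profiles_realizable (h1 h2 : R -> R) : profile h1 -> profile h2 ->
  (forall a, 0 < a -> a <= 1 -> - h2 a <= h1 a) ->
  exists2 M, isFc M & forall a, 0 < a -> a <= 1 ->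
    supp_fun M 1 a = h1 a /\ supp_fun M (-1) a = h2 a.
Proof.
move=> [d1 l1] [d2 l2] h12.
pose S x := [set a | [/\ 0 < a, a <= 1, x <= h1 a & - x <= h2 a]].
(* Since [sup set0] is 0, [M] vanishes outside all the segments. *)
pose M x := sup (S x).
have ubS x : has_ubound (S x) by exists 1 => a [].
have SM a x : S x a -> a <= M x by exact: ub_le_sup.
have M0 x : 0 <= M x.
  have [E|/set0P[a Sa]] := eqVneq (S x) set0; first by rewrite /M E sup0.
  by case: (Sa) => a0 _ _ _; exact: le_trans (ltW a0) (SM _ _ Sa).
have M1 x : M x <= 1.
  have [E|/set0P S0] := eqVneq (S x) set0; first by rewrite /M E sup0 ler01.
  by apply: ge_sup => // a [].
have Sne x : 0 < M x -> S x !=set0.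
  by move=> Mx; apply/set0P/eqP => E; move: Mx; rewrite /M E sup0 ltxx.
(* The supremum is attained: orders in [S x] exceed every [b < a], and left-continuity passes from
   those [b] to [a]. *)
have MS a x : 0 < a -> a <= 1 -> a <= M x -> S x a.
  move=> a0 a1 aM.
  have h b : 0 < b -> b < a -> x <= h1 b /\ - x <= h2 b.
    move=> b0 ba; have [c [c0 c1 xc1 xc2] bc] :=
      sup_gt (Sne _ (lt_le_trans a0 aM)) (lt_le_trans ba aM).
    by split; [apply: le_trans xc1 _; apply: d1|apply: le_trans xc2 _; apply: d2];
      rewrite ?(ltW b0) ?(ltW bc).
  by split => //; [apply: l1 => // b b0 ba|apply: l2 => // b b0 ba];
     have [] := h b b0 ba.
have levelM a : 0 < a -> a <= 1 -> level M a = `[- h2 a, h1 a]%classic.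
  move=> a0 a1; rewrite /level gt_eqF//; apply/seteqP; split=> x /=.
    by move=> /(MS _ _ a0 a1)[_ _ x1 x2]; rewrite in_itv/= x1 lerNl x2.
  by rewrite in_itv/= lerNl => /andP[x2 x1]; apply: SM; split.
have FM : isFc M.
  split=> [x|e /andP[]]; first by rewrite M0 M1.
  rewrite le_eqVlt => /predU1P[<- _|e0 e1]; last first.
    by exists (- h2 e), (h1 e); split; [exact: h12|exact: levelM].
  pose K := [set x | 0 < M x].
  have KP x : K x <-> exists a, S x a.
    split=> [/Sne[a]|[a Sa]]; first by exists a.
    by case: (Sa) => a0 _ _ _; apply: lt_le_trans (SM _ _ Sa).
  have K1 : K (h1 1) by apply/KP; exists 1; split => //; rewrite lerNl h12.
  have ubK : has_ubound K.
    by exists (h1 0) => x /KP[a [a0 a1 xa _]]; apply: le_trans xa _; apply: d1 => //; exact: ltW.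
  have lbK : has_lbound K.
    exists (- h2 0) => x /KP[a [a0 a1 _ xa]]; rewrite lerNl.
    by apply: le_trans xa _; apply: d2 => //; exact: ltW.
  have iK : is_interval K.
    move=> x y /KP[a [a0 a1 xa1 xa2]] /KP[b [b0 b1 yb1 yb2]] z /andP[xz zy].
    (* Segments grow as the order decreases, so the one of the smaller order contains both [x] and
       [y]. *)
    apply/KP; exists (Num.min a b).
    have m0 : 0 <= Num.min a b by rewrite le_min !ltW.
    split; [by rewrite lt_min a0|by rewrite ge_min a1| |].
      by apply: le_trans zy (le_trans yb1 _); apply: d1; rewrite // ge_min lexx orbT.
    by rewrite lerNl; apply: le_trans xz; rewrite lerNl; apply: le_trans xa2 _;
       apply: d2; rewrite // ge_min lexx.
  exists (inf K), (sup K); split; last first.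
    rewrite /level eqxx; apply: closure_interval => //; by exists (h1 1).
  by apply: le_trans (ge_inf lbK K1) (ub_le_sup ubK K1).
exists M => // a a0 a1.
have [l [r [lr E -> ->]]] := supp_fun_segment FM (ltW a0) a1.
move: E; rewrite levelM// => E.
have : `[- h2 a, h1 a]%classic l by rewrite E /= in_itv/= lexx.
have : `[- h2 a, h1 a]%classic r by rewrite E /= in_itv/= lr lexx.
have : `[l, r]%classic (- h2 a) by rewrite -E /= in_itv/= lexx h12.
have : `[l, r]%classic (h1 a) by rewrite -E /= in_itv/= lexx h12.
by rewrite /= !in_itv/=; split; lra.
Qed.

End SupportFunctions.

(** * Medians *)

Section Medians.
Context {d : measure_display} {T : measurableType d} {R : realType}.
Variable P : probability T R.
Implicit Types (Z : T -> R) (x t : R).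

Lemma ge_superlevels_measurable Z :
  (forall x, measurable [set w | x <= Z w]) -> measurable_fun setT Z.
Proof.
move=> mZ; apply: (measurability (@RGenCInfty.G R)) => [|/= _ [_] [r] -> <-].
  exact: RGenCInfty.measurableE.
rewrite setTI (_ : _ @^-1` _ = [set w | r <= Z w])//.
by apply/seteqP; split=> w /=; rewrite in_itv/= andbT.
Qed.

Lemma measurable_dist Z t : (forall x, measurable [set w | x <= Z w]) ->
  measurable_fun setT (fun w => (`|t - Z w|)%:E).
Proof.
move=> mZ; apply/measurable_EFinP; apply: measurableT_comp => //.
by apply: measurable_funB => //; exact: ge_superlevels_measurable.
Qed.

(** Continuity from above. It gives the attainment of medians and their left-continuity in the
    order. *)
Lemma probability_bigcap_ge (F : (set T)^nat) (p : \bar R) :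
  (forall n, measurable (F n)) -> (forall n, F n.+1 `<=` F n) ->
  (forall n, p <= P (F n))%E -> (p <= P (\bigcap_n F n))%E.
Proof.
move=> mF niF pF.
have FP : P \o F @ \oo --> P (\bigcap_n F n).
  apply: nonincreasing_cvg_mu => //.
  - by rewrite -ge0_fin_numE// fin_num_measure.
  - by apply: bigcap_measurable => //; exists 0%N.
  - by apply/nonincreasing_seqP => n; exact/subsetPset.
rewrite -(cvg_lim _ FP)//; apply: lime_ge; first by apply/cvg_ex; eexists; exact: FP.
by apply: nearW => n; exact: pF.
Qed.

(** The upper median. Being defined by superlevel sets, which are stable under decreasing
    intersections, it inherits the left-continuity of profiles. *)
Definition med Z : R := sup [set x | (2^-1%:E <= P [set w | (x <= Z w)%R])%E].

Lemma probability_setC_half (A : set T) : measurable A ->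
  (P A < 2^-1%:E)%E -> (2^-1%:E <= P (~` A))%E.
Proof.
move=> mA; rewrite probability_setC//.
rewrite -(@fineK _ (P A)) ?fin_num_measure// -EFinB lte_fin lee_fin; lra.
Qed.

Lemma le_half_set0 : ~ (2^-1%:E <= P set0)%E.
Proof. by rewrite measure0 lee_fin => ?; lra. Qed.

Lemma harmonic_lt (x y : R) : x < y -> exists n : nat, x + n.+1%:R^-1 < y.
Proof.
move=> xy; have yx : 0 < y - x by rewrite subr_gt0.
exists (Num.truncn (y - x)^-1); rewrite -ltrBrDl invf_plt ?posrE//.
exact: truncnS_gt.
Qed.

Section RandomVariable.
Variable Z : T -> R.
Hypothesis mZ : forall x, measurable [set w | x <= Z w].

Let mZ_lt x : measurable [set w | Z w < x].
Proof.
rewrite (_ : [set w | _] = ~` [set w | x <= Z w]); first exact: measurableC.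
by apply/seteqP; split=> w /=; rewrite ltNge => /negP.
Qed.

(** The events [Z w < - n] and [n <= Z w] decrease to the empty set, so neither family can keep
    probability at least one half. *)
Let med_has_sup : has_sup [set x | (2^-1%:E <= P [set w | (x <= Z w)%R])%E].
Proof.
split.
  apply: contrapT => h; apply: le_half_set0.
  have -> : set0 = \bigcap_n [set w | Z w < - n%:R].
    apply/seteqP; split=> // w /(_ (Num.truncn (- Z w)).+1 I) /=.
    by rewrite ltrNr ltNge => /negP; apply; apply: ltW; exact: truncnS_gt.
  apply: probability_bigcap_ge => // [n w /=|n].
    by move=> /lt_le_trans; apply; rewrite lerN2 ler_nat.
  rewrite (_ : [set w | _] = ~` [set w | - n%:R <= Z w]).
    apply: probability_setC_half => //; rewrite ltNge; apply/negP => hn.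
    by apply: h; exists (- n%:R).
  by apply/seteqP; split=> w /=; rewrite ltNge => /negP.
apply: contrapT => h; apply: le_half_set0.
have -> : set0 = \bigcap_n [set w | n%:R <= Z w].
  apply/seteqP; split=> // w /(_ (Num.truncn (Z w)).+1 I) /=.
  by rewrite leNgt truncnS_gt.
apply: probability_bigcap_ge => // [n w /=|n].
  by apply: le_trans; rewrite ler_nat.
rewrite leNgt; apply/negP => hn; apply: h; exists n%:R => x /= hx.
rewrite leNgt; apply/negP => nx; move: hn; rewrite ltNge => /negP; apply.
apply: le_trans hx _; apply: le_measure; rewrite ?inE// => w /=.
by apply: le_trans; exact: ltW.
Qed.

(** The supremum is attained, by continuity from above along [x - 1/(n+1)]. *)
Lemma le_med x : x <= med Z <-> (2^-1%:E <= P [set w | (x <= Z w)%R])%E.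
Proof.
split=> [xm|hx]; last by apply: ub_le_sup => //; case: med_has_sup.
have -> : [set w | x <= Z w] = \bigcap_n [set w | x - n.+1%:R^-1 <= Z w].
  apply/seteqP; split=> [w /= xZ n _ /=|w h /=].
    by apply: le_trans xZ; rewrite lerBlDr lerDl.
  rewrite leNgt; apply/negP => /harmonic_lt[n]; rewrite -ltrBrDr.
  by have := h n I; rewrite /= leNgt => /negP.
apply: probability_bigcap_ge => // [n w /=|n].
  by apply: le_trans; rewrite lerB// lef_pV2 ?posrE// ler_nat.
have [|y hy xy] := @sup_gt _ _ (x - n.+1%:R^-1) med_has_sup.1.
  by apply: lt_le_trans xm; rewrite ltrBlDr ltrDl.
apply: le_trans hy _; apply: le_measure; rewrite ?inE// => w /=.
by apply: le_trans; exact: ltW.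
Qed.

(** By maximality each [med Z + 1/(n+1)] is exceeded with probability below one half; the
    complements decrease to the event in question. *)
Lemma half_le_med : (2^-1%:E <= P [set w | (Z w <= med Z)%R])%E.
Proof.
have -> : [set w | Z w <= med Z] = \bigcap_n [set w | Z w < med Z + n.+1%:R^-1].
  apply/seteqP; split=> [w /= Zm n _ /=|w h /=].
    by apply: le_lt_trans Zm _; rewrite ltrDl.
  rewrite leNgt; apply/negP => /harmonic_lt[n].
  by have := h n I => /= h1 h2; have := lt_trans h1 h2; rewrite ltxx.
apply: probability_bigcap_ge => // [n w /=|n].
  by move=> /lt_le_trans; apply; rewrite lerD2l lef_pV2 ?posrE// ler_nat.
rewrite (_ : [set w | _] = ~` [set w | med Z + n.+1%:R^-1 <= Z w]).
  apply: probability_setC_half => //; rewrite ltNge; apply/negP => /le_med.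
  by rewrite gerDl leNgt invr_gt0 ltr0Sn.
by apply/seteqP; split=> w /=; rewrite ltNge => /negP.
Qed.

(* On A the distance to Z drops by |t - med Z| when t is replaced by med Z, off
   A it grows by at most as much, and A carries at least half of the mass. *)
Let med_min_half (A : set T) t : measurable A -> (2^-1%:E <= P A)%E ->
  (forall w, A w -> `|med Z - Z w| + `|t - med Z| <= `|t - Z w|) ->
  (\int[P]_w (`|med Z - Z w|)%:E <= \int[P]_w (`|t - Z w|)%:E)%E.
Proof.
set c : R := `|t - med Z| => mA hA h.
have mdist s := measurable_dist s mZ; have c0 : 0 <= c by exact: normr_ge0.
have mI (B : set T) : measurable B ->
    measurable_fun setT (fun w => c%:E * (\1_B w)%:E)%E.
  by move=> mB; apply: measurable_funeM; apply/measurable_EFinP; exact: measurable_indic.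
have E s (B : set T) : measurable B ->
    (\int[P]_w ((`|s - Z w|)%:E + c%:E * (\1_B w)%:E) =
     \int[P]_w (`|s - Z w|)%:E + c%:E * P B)%E.
  move=> mB; rewrite ge0_integralD//=; last 2 first.
  - by move=> w _; rewrite mule_ge0 ?lee_fin.
  - exact: mI.
  rewrite ge0_integralZl//=.
  - by rewrite integral_indic// setIT.
  - by apply/measurable_EFinP; exact: measurable_indic.
(* The gain on [A] and the loss off [A] are added on opposite sides, since the integrals may be
   infinite and cannot be subtracted. *)
have : (\int[P]_w ((`|med Z - Z w|)%:E + c%:E * (\1_A w)%:E) <=
        \int[P]_w ((`|t - Z w|)%:E + c%:E * (\1_(~` A) w)%:E))%E.
  apply: ge0_le_integral => //=.
  - by move=> w _; rewrite adde_ge0 ?mule_ge0 ?lee_fin.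
  - by apply: emeasurable_funD => //; exact: mI.
  - by apply: emeasurable_funD => //; apply: mI; exact: measurableC.
  - move=> w _; rewrite -!EFinM -!EFinD lee_fin !indicE in_setC.
    have [|_] := boolP (w \in A); first by rewrite inE mulr1 mulr0 addr0; exact: h.
    by have := ler_distD t (med Z) (Z w); rewrite (distrC (med Z) t) -/c /=; lra.
rewrite !E//; last exact: measurableC.
have cC : (c%:E * P (~` A) <= c%:E * P A)%E.
  apply: lee_wpmul2l; rewrite ?lee_fin// probability_setC//.
  move: hA; rewrite -(@fineK _ (P A)) ?fin_num_measure// -EFinB !lee_fin; lra.
move=> /le_trans /(_ (leeD2l _ cC)); rewrite leeD2rE// fin_numM//.
by rewrite fin_num_measure.
Qed.

(** The event of mass at least one half is the side of the median facing away from [t]. *)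
Lemma med_min t : (\int[P]_w (`|med Z - Z w|)%:E <= \int[P]_w (`|t - Z w|)%:E)%E.
Proof.
have [mt|tm] := leP (med Z) t.
  apply: (@med_min_half [set w | Z w <= med Z]) => [||w /= Zm].
  - rewrite (_ : [set w | _] = setT `&` Z @^-1` `]-oo, med Z]%classic).
      exact: ge_superlevels_measurable.
    by rewrite setTI; apply/seteqP; split=> w /=; rewrite in_itv.
  - exact: half_le_med.
  - by rewrite !ger0_norm ?subr_ge0//; lra.
apply: (@med_min_half [set w | med Z <= Z w]) => // [|w /= Zm].
  exact/le_med.
by rewrite !ler0_norm ?subr_le0; lra.
Qed.

End RandomVariable.

(** Ensures that the segments between medians are non-empty. For [y] strictly between [med Z1] and
    [- med Z2], the event [Z1 w < y] has mass at least one half and forces [- y <= Z2 w]. *)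
Lemma med_opp_le (Z1 Z2 : T -> R) :
  (forall x, measurable [set w | x <= Z1 w]) ->
  (forall x, measurable [set w | x <= Z2 w]) ->
  (forall w, - Z2 w <= Z1 w) -> - med Z2 <= med Z1.
Proof.
move=> mZ1 mZ2 Z12; rewrite leNgt; apply/negP => /midf_lt[].
set y := (_ / 2) => y1 y2.
suff : - y <= med Z2 by rewrite lerNl leNgt y2.
have Py : (P [set w | (y <= Z1 w)%R] < 2^-1%:E)%E.
  by rewrite ltNge; apply/negP => /(le_med mZ1); rewrite leNgt y1.
apply/le_med => //; apply: le_trans (probability_setC_half (mZ1 y) Py) _.
apply: le_measure; rewrite ?inE//; first exact: measurableC.
move=> w /= /negP; rewrite -ltNge => Zy; rewrite lerNl.
exact: le_trans (Z12 w) (ltW Zy).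
Qed.

(* |u - z| is at most a convex combination of |a - z| and |v - z| up to the defect
   |a - u| + |u - v| - |a - v|. *)
Lemma dist_quasi_convex (a u v : R) : exists k l, [/\ 0 <= k, 0 <= l, k + l = 1 &
  forall z, `|u - z| + `|a - v| <=
    k * `|a - z| + l * `|v - z| + (`|a - u| + `|u - v|)].
Proof.
(* On the line one of the three points lies between the others: [a] in this case, [v] in the next,
   and [u] in the last, where the weights are those of linear interpolation. *)
have [av|av] := leP `|a - v| (`|u - v| - `|a - u|).
  exists 1, 0; split=> // [|z]; first by rewrite addr0.
  by have := ler_distD a u z; rewrite (distrC u a); have := normr_ge0 (a - u); lra.
have [va|va] := leP `|a - v| (`|a - u| - `|u - v|).
  exists 0, 1; split=> // [|z]; first by rewrite add0r.
  by have := ler_distD v u z; have := normr_ge0 (u - v); lra.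
have [k [l [k0 l0 kl uE]]] : exists k l, [/\ 0 <= k, 0 <= l, k + l = 1 & u = k * a + l * v].
  wlog lt : a v av va / a < v.
    move=> W; case: (ltgtP a v) => [lt|lt|E]; first exact: W.
      have [|||l [k [l0 k0 kl uE]]] := W v a.
      - by rewrite (distrC v a) (distrC v u) (distrC u a); lra.
      - by rewrite (distrC v a) (distrC v u) (distrC u a); lra.
      - exact: lt.
      by exists k, l; split=> //; rewrite ?uE addrC.
    by move: av va; rewrite E subrr normr0 (distrC v); lra.
  exists ((v - u) / (v - a)), ((u - a) / (v - a)).
  have d0 : 0 < v - a by rewrite subr_gt0.
  have [au uv] : a <= u /\ u <= v.
    move: av va; case: (ler0P (a - u)); case: (ler0P (u - v)); case: (ler0P (a - v)); lra.
  split; try (by rewrite divr_ge0 ?subr_ge0// ltW); field; lra.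
exists k, l; split=> // z.
apply: lerD; last exact: ler_distD.
have -> : u - z = k * (a - z) + l * (v - z).
  by rewrite uE !mulrBr addrACA -opprD -mulrDl kl mul1r.
by apply: le_trans (ler_normD _ _) _; rewrite !normrM (ger0_norm k0) (ger0_norm l0).
Qed.

End Medians.

(** * Mean distances to a stochastic support function *)

Section Cost.
Context {d : measure_display} {T : measurableType d} {R : realType}.
Variable P : probability T R.

(** After integration, the convex combination is at most the larger of the mean distances of [a] and
    [v], while that of [m] is at most the smaller. No subtraction occurs, so infinite means are
    allowed. *)
Lemma mean_dist_quasi_convex (Z : T -> R) (a u v m : R) :
  (forall x, measurable [set w | x <= Z w]) ->
  (forall t, \int[P]_w (`|m - Z w|)%:E <= \int[P]_w (`|t - Z w|)%:E)%E ->
  (\int[P]_w (`|u - Z w|)%:E + \int[P]_w (`|m - Z w|)%:E + (`|a - v|)%:E <=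
   \int[P]_w (`|v - Z w|)%:E + \int[P]_w (`|a - Z w|)%:E +
     (`|a - u| + `|u - v|)%:E)%E.
Proof.
move=> mZ mmin; pose e t := (\int[P]_w (`|t - Z w|)%:E)%E.
have mdist t := measurable_dist t mZ.
have e0 t : (0 <= e t)%E by apply: integral_ge0 => w _; rewrite lee_fin.
rewrite -!/(e _); set D := _ + `|u - v|.
have icst (c : R) : (\int[P]_w c%:E = c%:E)%E.
  rewrite integral_cst// -[RHS]mule1; congr (_ * _)%E; exact: probability_setT.
have [k [l [k0 l0 kl h]]] := dist_quasi_convex a u v.
have mk c t : measurable_fun setT (fun w => c%:E * (`|t - Z w|)%:E)%E.
  exact: measurable_funeM.
have D0 : 0 <= D by rewrite addr_ge0.
have uav : (e u + (`|a - v|)%:E <= k%:E * e a + l%:E * e v + D%:E)%E.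
  rewrite -(icst `|a - v|) -(icst D) /e -!ge0_integralZl//.
  have mkl : measurable_fun setT
      (fun w => k%:E * (`|a - Z w|)%:E + l%:E * (`|v - Z w|)%:E)%E.
    exact: emeasurable_funD.
  rewrite -!ge0_integralD//=; try exact: mkl;
    try by move=> w _; rewrite ?adde_ge0 ?mule_ge0.
  apply: ge0_le_integral => //=.
  - by move=> w _; rewrite adde_ge0.
  - exact: emeasurable_funD.
  - exact: emeasurable_funD.
  - by move=> w _; rewrite -!EFinM -!EFinD lee_fin.
(* Here [y] stands for the one of [a], [v] with the larger mean distance, and [x] for the other. *)
have key x y : (e x <= e y)%E -> (k%:E * e a + l%:E * e v <= e y)%E ->
    (e u + e m + (`|a - v|)%:E <= e y + e x + D%:E)%E.
  move=> xy kly; rewrite addeAC [leRHS]addeAC; apply: leeD; last exact: mmin.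
  by apply: le_trans uav _; exact: leeD2r.
have comb y : (e a <= e y)%E -> (e v <= e y)%E ->
    (k%:E * e a + l%:E * e v <= e y)%E.
  move=> ay vy; rewrite -[leRHS]mul1e -kl EFinD ge0_muleDl ?lee_fin//.
  by apply: leeD; apply: lee_wpmul2l; rewrite ?lee_fin.
have [av|/ltW va] := leP (e a) (e v).
  by apply: key => //; exact: comb.
by rewrite [X in (_ <= X + _)%E]addeC; apply: key => //; exact: comb.
Qed.

End Cost.

(** * Random profiles: distances, joint measurability and pointwise medians *)

Section Processes.
Context {R : realType}.

Local Notation I01 := (`]0%R, 1%R]%classic : set R).

Lemma profile_bounded (h : R -> R) a : profile h -> 0 < a -> a <= 1 ->
  h 1 <= h a <= h 0.
Proof. by move=> [dh _] a0 a1; apply/andP; split; apply: dh; rewrite // ltW. Qed.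

Lemma measurable_profile (h : R -> R) :
  profile h -> measurable_fun I01 h.
Proof.
move=> [dh _]; apply: (measurability (@RGenCInfty.G R)) => [|/= _ [_] [r] -> <-].
  exact: RGenCInfty.measurableE.
apply: is_interval_measurable => s t /= [].
rewrite !in_itv/= !andbT => /andP[s0 s1] rs [/andP[t0 t1] rt] x /andP[sx xt].
have x0 := lt_le_trans s0 sx; have x1 := le_trans xt t1.
rewrite /= !in_itv/= x0 x1 !andbT; split => //.
by apply: le_trans rt _; apply: dh => //; exact: ltW.
Qed.

(** Order 0 is left out: it is a null set, and profiles are controlled by left-continuity only on
    []0, 1]]. *)
Definition pdist (h k : R -> R) : \bar R :=
  (\int[lebesgue_measure]_(a in I01) (`|h a - k a|)%:E)%E.

Lemma measurable_pdist (h k : R -> R) : profile h -> profile k ->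
  measurable_fun I01 (fun a => (`|h a - k a|)%:E).
Proof.
move=> ph pk; apply/measurable_EFinP; apply: measurableT_comp => //.
by apply: measurable_funB; exact: measurable_profile.
Qed.

Lemma pdist_ge0 h k : (0 <= pdist h k)%E.
Proof. by apply: integral_ge0 => a _; rewrite lee_fin. Qed.

Lemma pdist_fin_num h k : profile h -> profile k -> pdist h k \is a fin_num.
Proof.
move=> ph pk; rewrite ge0_fin_numE ?pdist_ge0//.
(* The total drops of [h] and [k] plus their distance at order 1. *)
pose c := h 0 - h 1 + (k 0 - k 1) + `|h 1 - k 1|.
have bd a : I01 a -> ((`|h a - k a|)%:E <= c%:E)%E.
  rewrite /= in_itv/= lee_fin => /andP[a0 a1].
  have /andP[? ?] := profile_bounded ph a0 a1.
  have /andP[? ?] := profile_bounded pk a0 a1.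
  rewrite /c; have := ler_norm (h 1 - k 1); have := ler_norm (k 1 - h 1).
  rewrite distrC; case: (ler0P (h a - k a)); lra.
apply: (@le_lt_trans _ _ (\int[lebesgue_measure]_(a in I01) (cst c%:E a))%E).
  apply: ge0_le_integral => //=.
  exact: measurable_pdist.
rewrite integral_cst//= lebesgue_measure_itv/= lte_fin ltr01.
by rewrite -EFinD -EFinM ltry.
Qed.

Context {d : measure_display} {T : measurableType d}.
Variable P : probability T R.

(** Measurability is asked at each fixed order; the joint measurability that Tonelli requires is
    derived from the profile conditions. *)
Definition process (Y : T -> R -> R) : Prop :=
  (forall w, profile (Y w)) /\
  (forall a x, 0 <= a -> a <= 1 -> measurable [set w | x <= Y w a]).

Lemma process_cst h : profile h -> process (fun=> h).
Proof.
move=> ph; split=> // a x _ _; have [xh|hx] := boolP (x <= h a).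
  by rewrite (_ : [set _ | _] = setT)//; apply/seteqP; split.
by rewrite (_ : [set _ | _] = set0)//; apply/seteqP; split.
Qed.

(* By left-continuity, x <= Y w a fails as soon as x <= Y w q fails for some rational
   0 < q < a, which makes the superlevel sets countable combinations of rectangles. *)
Lemma measurable_process Y : process Y ->
  measurable_fun ([set: T] `*` I01) (fun z : T * R => Y z.1 z.2).
Proof.
move=> [pY mY]; apply: (measurability (@RGenCInfty.G R)) => [|/= _ [_] [x] -> <-].
  exact: RGenCInfty.measurableE.
pose B (q : rat) : set (T * R) := if (0 < ratr q :> R) && (ratr q < 1 :> R)
  then (~` [set w | x <= Y w (ratr q)]) `*` `](ratr q : R), +oo[%classic else set0.
rewrite (_ : _ `&` _ = ([set: T] `*` I01) `\` \bigcup_q B q).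
  apply: measurableD; first exact: measurableX.
  apply: bigcupT_measurable_rat => q; rewrite /B; case: ifPn => // /andP[q0 q1].
  by apply: measurableX => //; apply: measurableC; apply: mY; exact: ltW.
apply/seteqP; split=> -[w a] /=.
  rewrite !in_itv/= !andbT => -[[_ /andP[a0 a1]]] xY; split; first by split=> //; rewrite a0.
  move=> -[q _].
  rewrite /B; case: ifPn => // /andP[q0 q1] []/=; rewrite in_itv/= andbT => nxY qa.
  by apply: nxY; apply: le_trans xY _; apply: (pY w).1; rewrite // ltW.
rewrite !in_itv/= !andbT => -[[_ /andP[a0 a1]]] nB; split; first by split=> //; rewrite a0.
apply: (pY w).2 => // b b0 ba; have [q] := rat_in_itvoo ba; rewrite in_itv/= => /andP[bq qa].
have q0 := lt_trans b0 bq; have q1 := lt_le_trans qa a1.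
apply: (@le_trans _ _ (Y w (ratr q))); last by apply: (pY w).1; rewrite // ltW.
apply: contrapT => nxY; apply: nB; exists q => //; rewrite /B q0 q1 /=; split => //=.
by rewrite in_itv/= qa.
Qed.

(** By left-continuity, the event [x <= Y w a] is the decreasing intersection of the events at
    orders [b n] increasing to [a], so a lower bound of one half persists. *)
Lemma profile_med Y : process Y -> profile (fun a => med P (Y^~ a)).
Proof.
move=> [pY mY]; split=> [a b a0 ab b1|a x a0 a1 xm].
  have a1 := le_trans ab b1; have b0 := le_trans a0 ab.
  apply/le_med => [x|]; first exact: mY.
  have /(le_med P (fun x => mY b x b0 b1)) := lexx (med P (Y^~ b)).
  move=> /le_trans; apply; apply: le_measure; rewrite ?inE; try exact: mY.
  by move=> w /= h; apply: le_trans h _; apply: (pY w).1.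
apply/le_med => [y|]; first by apply: mY; rewrite // ltW.
(* The shift by 2 keeps [b 0] positive. *)
pose b n := a - a / n.+2%:R.
have ba n : b n < a by rewrite /b gtrBl divr_gt0.
have b0 n : 0 < b n.
  rewrite /b subr_gt0 ltr_pdivrMr// -[ltLHS]mulr1 ltr_pM2l// ltr1n.
  by [].
have b1 n := le_trans (ltW (ba n)) a1.
have -> : [set w | x <= Y w a] = \bigcap_n [set w | x <= Y w (b n)].
  apply/seteqP; split=> [w /= xY n _ /=|w h /=].
    by apply: le_trans xY _; apply: (pY w).1; rewrite // ltW.
  apply: (pY w).2 => // c c0 /harmonic_lt[n cn].
  apply: le_trans (h n I) _ => /=; apply: (pY w).1; rewrite ?(ltW c0)//.
  rewrite /b lerBrDr; apply: le_trans (ltW cn); rewrite lerD2l.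
  rewrite ler_pdivrMr//; apply: le_trans a1 _.
  by rewrite mulrC ler_pdivlMr// mul1r ler_nat.
apply: probability_bigcap_ge => [n|n w /=|n].
- by apply: mY; rewrite // ltW.
- move=> h; apply: le_trans h _; apply: (pY w).1; rewrite ?(ltW (b0 _))//.
  by rewrite /b lerB// ler_pM2l// lef_pV2 ?posrE// ler_nat.
- by apply/(le_med P (fun y => mY (b n) y (ltW (b0 n)) (b1 n))); exact: xm.
Qed.

Definition mean_dist (h : R -> R) (Y : T -> R -> R) (a : R) : \bar R :=
  (\int[P]_w (`|h a - Y w a|)%:E)%E.

(** Extension by zero to the whole product, the setting of Tonelli's theorem. *)
Let F (h : R -> R) (Y : T -> R -> R) : T * R -> \bar R :=
  (fun z => (`|h z.2 - Y z.1 z.2|)%:E) \_ ([set: T] `*` I01).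

Let F0 h Y z : (0 <= F h Y z)%E.
Proof. by rewrite /F /patch; case: ifP => // _; rewrite lee_fin. Qed.

Let mF h Y : profile h -> process Y -> measurable_fun setT (F h Y).
Proof.
move=> ph pY; apply/measurable_restrict => //; first exact: measurableX.
rewrite setTI; apply/measurable_EFinP; apply: measurableT_comp => //.
apply: measurable_funB; last exact: measurable_process.
exact: measurable_process (process_cst ph).
Qed.

Let FE h Y w a : F h Y (w, a) =
  ((fun a => (`|h a - Y w a|)%:E) \_ (I01)) a.
Proof. by rewrite /F /patch in_setX in_setT. Qed.

Let F_fst h Y w : (\int[lebesgue_measure]_a F h Y (w, a))%E = pdist h (Y w).
Proof. by rewrite /pdist [RHS]integral_mkcond; apply: eq_integral => a _; rewrite FE. Qed.

Let F_snd h Y : (fun a => \int[P]_w F h Y (w, a))%E = mean_dist h Y \_ (I01).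
Proof.
apply/funext => a; under eq_integral do rewrite FE /patch.
by rewrite /patch; case: ifP => // _; rewrite integral0.
Qed.

Lemma measurable_pdist_process h Y : profile h -> process Y ->
  measurable_fun setT (fun w => pdist h (Y w)).
Proof.
move=> ph pY.
have := measurable_fun_fubini_tonelli_F (m2 := lebesgue_measure) _ (mF ph pY) (F0 h Y).
by congr (measurable_fun _ _); apply/funext => w; exact: F_fst.
Qed.

Lemma measurable_mean_dist h Y : profile h -> process Y ->
  measurable_fun I01 (mean_dist h Y).
Proof.
move=> ph pY.
have := measurable_fun_fubini_tonelli_G (m1 := P) _ (mF ph pY) (F0 h Y).
rewrite /fubini_G F_snd => /measurable_restrict; rewrite setTI; apply => //.
Qed.

(** Tonelli: the mean distance can be studied separately at each order. *)
Lemma mean_pdist h Y : profile h -> process Y ->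
  (\int[P]_w pdist h (Y w) =
   \int[lebesgue_measure]_(a in I01) mean_dist h Y a)%E.
Proof.
move=> ph pY; rewrite [RHS]integral_mkcond -F_snd.
rewrite -(fubini_tonelli (m1 := P) (m2 := lebesgue_measure) _ (mF ph pY) (F0 h Y)).
by apply: eq_integral => w _; rewrite F_fst.
Qed.

Lemma mean_pdist_quasi_convex Y a u v : process Y ->
  profile a -> profile u -> profile v ->
  (\int[P]_w pdist u (Y w) + \int[P]_w pdist (fun t => med P (Y^~ t)) (Y w) + pdist a v <=
   \int[P]_w pdist v (Y w) + \int[P]_w pdist a (Y w) + (pdist a u + pdist u v))%E.
Proof.
move=> pY pa pu pv; have pm := profile_med pY.
rewrite !mean_pdist//.
have md h : profile h -> measurable_fun I01 (mean_dist h Y).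
  by move=> ph; exact: measurable_mean_dist.
have md0 h t : (0 <= mean_dist h Y t)%E.
  by apply: integral_ge0 => w _; rewrite lee_fin.
rewrite /pdist -!ge0_integralD//; first last.
all: try by move=> *; first [exact: adde_ge0 | rewrite lee_fin].
all: try exact: measurable_pdist.
all: try exact: md.
all: try by apply: emeasurable_funD; first [exact: md | exact: measurable_pdist].
apply: ge0_le_integral => //.
- by move=> t _; apply: adde_ge0; [exact: adde_ge0|rewrite lee_fin].
- by apply: emeasurable_funD; [apply: emeasurable_funD; exact: md|exact: measurable_pdist].
- by apply: emeasurable_funD; apply: emeasurable_funD;
    first [exact: md | exact: measurable_pdist].
- move=> t /=; rewrite in_itv/= => /andP[t0 t1]; rewrite -EFinD.
  have mY x := pY.2 t x (ltW t0) t1.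
  by apply: mean_dist_quasi_convex => // s; exact: med_min.
Qed.

End Processes.

(** * The natural depth *)

Section NaturalDepth.
Context {R : realType}.

Lemma rho1_pdist (A B : R -> R) : isFc A -> isFc B ->
  rho1 A B = (2^-1%:E * (pdist (supp_fun A 1) (supp_fun B 1) +
                         pdist (supp_fun A (-1)) (supp_fun B (-1))))%E.
Proof.
move=> FA FB; rewrite /rho1 /pdist -!integral_itv_obnd_cbnd//;
  by apply: measurable_pdist; apply: profile_supp_fun; rewrite // ?normrN normr1.
Qed.

Context {d : measure_display} {T : measurableType d}.
Variables (P : probability T R) (X : T -> R -> R).
Hypothesis frvX : fuzzy_random_variable X.

(** The event [x <= supp_fun (X w) u a] says that the level hits a closed half-line; cutting it by
    [[-n, n]] gives countably many compact hitting sets. *)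
Lemma process_supp_fun u : `|u| = 1 -> process (fun w => supp_fun (X w) u).
Proof.
move=> u1; split=> [w|a x a0 a1].
  by apply: profile_supp_fun => //; exact: frvX.1.
have a01 : 0 <= a <= 1 by rewrite a0.
rewrite (_ : [set w | _] =
    \bigcup_n [set w | level (X w) a `&`
      (`[- n%:R, n%:R] `&` [set v | x <= u * v]) !=set0]).
  apply: bigcupT_measurable => n; apply: (frvX.2 _ a01).2.
  apply: compact_closedI; first exact: segment_compact.
  have [->|->] := norm1_cases u1.
    rewrite (_ : [set _ | _] = `[x, +oo[%classic); first exact: interval_closed.
    by apply/seteqP; split=> v /=; rewrite in_itv/= andbT mul1r.
  rewrite (_ : [set _ | _] = `]-oo, - x]%classic); first exact: interval_closed.
  by apply/seteqP; split=> v /=; rewrite in_itv/= mulN1r lerNr.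
apply/seteqP; split=> [w /= /(le_supp_fun _ (frvX.1 w) u1 a0 a1)[v va xv]|].
  exists (Num.truncn `|v|).+1 => //=; exists v; split=> //; split=> //=.
  rewrite in_itv/= -ler_norml; apply: ltW; exact: truncnS_gt.
move=> w /= [n _ /= [v [va [_ xv]]]].
by apply/(le_supp_fun _ (frvX.1 w) u1 a0 a1); exists v.
Qed.

Let n1 : `|1 : R| = 1. Proof. exact: normr1. Qed.
Let nN1 : `|-1 : R| = 1. Proof. by rewrite normrN normr1. Qed.

Let Y u w := supp_fun (X w) u.

Lemma mean_rho1 B : isFc B -> (\int[P]_w rho1 B (X w) =
  2^-1%:E * (\int[P]_w pdist (supp_fun B 1) (Y 1 w) +
             \int[P]_w pdist (supp_fun B (-1)) (Y (-1) w)))%E.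
Proof.
move=> FB.
under eq_integral => w _ do rewrite (rho1_pdist FB (frvX.1 w)).
have mp u : `|u| = 1 -> measurable_fun setT (fun w => pdist (supp_fun B u) (Y u w)).
  by move=> u1; apply: measurable_pdist_process;
    [exact: profile_supp_fun|exact: process_supp_fun].
rewrite ge0_integralZl//=.
- by rewrite ge0_integralD//=; try (by move=> w _; exact: pdist_ge0); exact: mp.
- by apply: emeasurable_funD; exact: mp.
- by move=> w _; rewrite adde_ge0// pdist_ge0.
Qed.

Lemma rho1_ge0 (A B : R -> R) : (0 <= rho1 A B)%E.
Proof.
rewrite mule_ge0 ?lee_fin ?invr_ge0// adde_ge0//;
  by apply: integral_ge0 => a _; rewrite lee_fin.
Qed.

Lemma mean_rho1_ge0 B : (0 <= \int[P]_w rho1 B (X w))%E.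
Proof. by apply: integral_ge0 => w _; exact: rho1_ge0. Qed.

(** Combines the inequalities for [u = 1] and [u = -1]; nonnegativity licenses distributivity in the
    extended reals. *)
Let lee_scaled_sum (k : R) (a a' b b' c c' x x' y y' z z' t t' : \bar R) :
  (0 <= k)%R ->
  (0 <= a)%E -> (0 <= a')%E -> (0 <= b)%E -> (0 <= b')%E -> (0 <= c)%E -> (0 <= c')%E ->
  (0 <= x)%E -> (0 <= x')%E -> (0 <= y)%E -> (0 <= y')%E ->
  (0 <= z)%E -> (0 <= z')%E -> (0 <= t)%E -> (0 <= t')%E ->
  (a + b + c <= x + y + (z + t))%E -> (a' + b' + c' <= x' + y' + (z' + t'))%E ->
  (k%:E * (a + a') + k%:E * (b + b') + k%:E * (c + c') <=
   k%:E * (x + x') + k%:E * (y + y') + (k%:E * (z + z') + k%:E * (t + t')))%E.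
Proof.
move=> k0 a0 a'0 b0 b'0 c0 c'0 x0 x'0 y0 y'0 z0 z'0 t0 t'0 le1 le2.
rewrite -!ge0_muleDr ?adde_ge0//; apply: lee_wpmul2l; first by rewrite lee_fin.
rewrite (addeACA a) (addeACA x) (addeACA z) [leLHS]addeACA [leRHS]addeACA.
exact: leeD.
Qed.

Lemma median_Fc : exists2 M, isFc M & forall A U V, isFc A -> isFc U -> isFc V ->
  (\int[P]_w rho1 U (X w) + \int[P]_w rho1 M (X w) + rho1 A V <=
   \int[P]_w rho1 V (X w) + \int[P]_w rho1 A (X w) + (rho1 A U + rho1 U V))%E.
Proof.
have p1 := process_supp_fun n1; have pN1 := process_supp_fun nN1.
have [|M FM ME] := profiles_realizable (profile_med P p1) (profile_med P pN1).
  move=> a a0 a1; apply: med_opp_le => [x|x|w].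
  - by apply: p1.2; rewrite // ltW.
  - by apply: pN1.2; rewrite // ltW.
  - have [l [r [lr _ -> ->]]] := supp_fun_segment (frvX.1 w) (ltW a0) a1.
    by rewrite opprK.
exists M => // A U V FA FU FV.
have ps (B : R -> R) u : isFc B -> `|u| = 1 -> profile (supp_fun B u).
  by move=> *; exact: profile_supp_fun.
(* [M] is known to realize the medians only on []0, 1]], which is the domain of integration in
   [pdist]. *)
have hM u : `|u| = 1 -> (\int[P]_w pdist (supp_fun M u) (Y u w) =
    \int[P]_w pdist (fun a => med P ((Y u)^~ a)) (Y u w))%E.
  move=> u1; apply: eq_integral => w _; apply: eq_integral => a.
  rewrite inE /= in_itv/= => /andP[a0 a1]; have [E1 EN1] := ME a a0 a1.
  by have [->|->] := norm1_cases u1; rewrite ?E1 ?EN1.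
have q1 := mean_pdist_quasi_convex P p1 (ps _ _ FA n1) (ps _ _ FU n1) (ps _ _ FV n1).
have qN1 := mean_pdist_quasi_convex P pN1 (ps _ _ FA nN1) (ps _ _ FU nN1) (ps _ _ FV nN1).
rewrite -(hM _ n1) in q1; rewrite -(hM _ nN1) in qN1.
rewrite (mean_rho1 FU) (mean_rho1 FM) (mean_rho1 FV) (mean_rho1 FA).
rewrite (rho1_pdist FA FV) (rho1_pdist FA FU) (rho1_pdist FU FV).
have mp0 (h : R -> R) (Z : T -> R -> R) : (0 <= \int[P]_w pdist h (Z w))%E.
  by apply: integral_ge0 => w _; exact: pdist_ge0.
by apply: lee_scaled_sum; rewrite ?invr_ge0//; first [exact: mp0 | exact: pdist_ge0].
Qed.

(** Isolates the dependence of [D1] on the expected distance, so that monotonicity is checked on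
    extended reals. *)
Let depth (x : \bar R) : R := if x is r%:E then (1 + r)^-1 else 0.

Let depth_ge0 x : (0 <= x)%E -> 0 <= depth x.
Proof. by case: x => [r| |] //=; rewrite lee_fin => r0; rewrite invr_ge0 addr_ge0. Qed.

Let depth_le1 x : (0 <= x)%E -> depth x <= 1.
Proof.
case: x => [r| |] //= r0; rewrite invf_le1 ?lerDl//.
by rewrite ltr_pwDl.
Qed.

Let le_depth x y : (0 <= x)%E -> (x <= y)%E -> depth y <= depth x.
Proof.
case: x => [r| |] //; case: y => [s| |] //= => [|r0 _].
  rewrite !lee_fin => r0 rs; have s0 := le_trans r0 rs.
  by rewrite lef_pV2 ?posrE ?lerD2l// ltr_pwDl.
by rewrite invr_ge0 addr_ge0.
Qed.

Let depth_le x y : x \is a fin_num -> (0 <= x)%E -> (0 <= y)%E ->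
  depth y <= depth x -> (x <= y)%E.
Proof.
case: x => [r| |] // _; case: y => [s| |] //= r0 s0; last by rewrite leey.
by rewrite lef_pV2 ?posrE ?lerD2l// ltr_pwDl.
Qed.

Lemma D1_ge0 B : 0 <= D1 P B X.
Proof. by apply: depth_ge0; exact: mean_rho1_ge0. Qed.

Lemma D1_le A B : (\int[P]_w rho1 A (X w) <= \int[P]_w rho1 B (X w))%E ->
  D1 P B X <= D1 P A X.
Proof. by apply: le_depth; exact: mean_rho1_ge0. Qed.

Lemma le_mean_rho1 A B : (\int[P]_w rho1 A (X w))%E \is a fin_num ->
  D1 P B X <= D1 P A X -> (\int[P]_w rho1 A (X w) <= \int[P]_w rho1 B (X w))%E.
Proof. by move=> fA; apply: depth_le => //; exact: mean_rho1_ge0. Qed.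

(** Depths are bounded by 1, so [sup] is a true least upper bound and not a default value. *)
Lemma D1_le_sup B : isFc B -> D1 P B X <= sup [set D1 P C X | C in @isFc R].
Proof.
move=> FB; apply: ub_le_sup; last by exists B.
by exists 1 => _ [C _ <-]; apply: depth_le1; exact: mean_rho1_ge0.
Qed.

End NaturalDepth.

Theorem theorem4p3 (R : realType) (d : measure_display) (T : measurableType d)
  (P : probability T R) (X : T -> R -> R) :
  fuzzy_random_variable X ->
  (\int[P]_w (norm0 (X w))%:E < +oo)%E ->
  forall A : R -> R, isFc A ->
  D1 P A X = sup [set D1 P B X | B in @isFc R] ->
  forall U V : R -> R, isFc U -> isFc V ->
  rho1 A V = (rho1 A U + rho1 U V)%E ->
  D1 P U X <= D1 P A X /\ D1 P V X <= D1 P U X.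
Proof.
move=> frvX _ A FA Amax U V FU FV AUV.
have leA B : isFc B -> D1 P B X <= D1 P A X by rewrite Amax; exact: D1_le_sup.
split; first exact: leA.
(* If the expectation for [A] is not finite, the depth of [A] is 0, so that of [V] is at most 0. *)
have [fA|nfA] := boolP ((\int[P]_w rho1 A (X w))%E \is a fin_num); last first.
  apply: le_trans (leA _ FV) (le_trans _ (D1_ge0 P X U)).
  by rewrite /D1; case: (\int[P]_w _)%E nfA => [r /negP[]| |].
have [M FM /(_ A U V FA FU FV)] := median_Fc P frvX.
have fAV : rho1 A V \is a fin_num.
  rewrite rho1_pdist// fin_numM// fin_numD !pdist_fin_num//;
    by apply: profile_supp_fun; rewrite // ?normrN normr1.
(* The two cancellations are legitimate because [rho1 A V] and the mean distance of [A] are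
   finite. *)
rewrite -AUV (leeD2rE _ _ fAV) => h; apply: D1_le.
rewrite -(leeD2rE _ _ fA); apply: le_trans h; apply: leeD2l.
exact: le_mean_rho1 fA (leA M FM).
Qed.
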